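(* Let $P$ be a commutative unital semigroup generated by a set $\{p_i\}_{i\in I}$, let $\mathcal{H}$ be a Hilbert space, and let $T:P\to\mathcal{B}(\mathcal{H})$ be a unital contractive representation. Then the family $\{T(p_i)\}_{i\in I}$ has commuting normal extensions $\{N_i\}_{i\in I}$ (that is, there are a Hilbert space $\mathcal{L}\supseteq\mathcal{H}$ and pairwise commuting normal operators $N_i\in\mathcal{B}(\mathcal{L})$, $i\in I$, with $N_i$ extending $T(p_i)$ for each $i$) if and only if there exist a Hilbert space $\mathcal{K}\supseteq\mathcal{H}$ and a normal representation $N:P\to\mathcal{B}(\mathcal{K})$ such that $N(p)$ extends $T(p)$ for each $p\in P$.
   Context: A unital semigroup is a semigroup with an identity element $e$. A (unital) representation of a unital semigroup $P$ on a Hilbert space $\mathcal{H}$ is a map $T:P\to\mathcal{B}(\mathcal{H})$ into the bounded operators with $T(e)=I$ and $T(pq)=T(p)T(q)$ for all $p,q\in P$. It is contractive if $\|T(p)\|\le 1$ for all $p\in P$, and normal if every $T(p)$ is a normal operator. For $T\in\mathcal{B}(\mathcal{H})$ and $S\in\mathcal{B}(\mathcal{K})$ with $\mathcal{H}\subseteq\mathcal{K}$ a closed subspace, $S$ extends $T$ if $S\mathcal{H}\subseteq\mathcal{H}$ and $S|_{\mathcal{H}}=T$. ''Generated by $\{p_i\}_{i\in I}$'' means that every element of $P$ is a finite (possibly empty) product of the $p_i$. *)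

(* Defs.v *)
From HB Require Import structures.
From mathcomp Require Import all_boot all_order all_algebra.
From mathcomp Require Import all_classical all_reals topology normedtype.
From mathcomp Require Import complex.
Set Implicit Arguments.
Unset Strict Implicit.
Unset Printing Implicit Defensive.
Import Order.TTheory GRing.Theory Num.Theory.
Import numFieldNormedType.Exports.
Local Open Scope classical_set_scope.
Local Open Scope ring_scope.

(* The inner product is linear in its first argument, conjugate-linear in its
   second. *)
HB.mixin Record NormedModule_hasInnerProduct (R : realType) (H : Type)
    of NormedModule R[i] H := {
  dotp : {dot H for (@Num.conj R[i])} ;
  dotp_norm : forall x : H, dotp x x = `|x| ^+ 2 }.

#[short(type="hilbertType")]
HB.structure Definition Hilbert (R : realType) :=
  {H of CompleteNormedModule R[i] H & NormedModule_hasInnerProduct R H}.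

Arguments dotp {R} s.

Record boundedOp (R : realType) (H : hilbertType R) := BoundedOp {
  bop_linear :> {linear H -> H} ;
  bop_bounded : bounded_near bop_linear (nbhs (0 : H)) }.

Section BoundedOpMonoid.
Context (R : realType) (H : hilbertType R).
Implicit Types A B C : boundedOp H.

HB.instance Definition _ := gen_eqMixin (boundedOp H).
HB.instance Definition _ := gen_choiceMixin (boundedOp H).

Lemma boundedOpP A B : A =1 B -> A = B.
Proof.
case: A B => [f hf] [g hg] /= fg.
have {}fg : f = g.
  case: f g fg {hf hg} => f cf [g cg] /= /funext fg.
  by subst g; congr GRing.Linear.Pack; case: cf cg => -[?] [?] [[?] [?]];
    congr GRing.Linear.Class; congr (_ _); exact: Prop_irrelevance.
by subst g; congr BoundedOp; exact: Prop_irrelevance.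
Qed.

Lemma idop_bounded : bounded_near (idfun : {linear H -> H}) (nbhs (0 : H)).
Proof. by apply/linear_bounded_continuous => x; exact: cvg_id. Qed.

Definition idop : boundedOp H := BoundedOp idop_bounded.

Lemma compop_bounded A B :
  bounded_near (bop_linear A \o bop_linear B : {linear H -> H}) (nbhs (0 : H)).
Proof.
apply/linear_bounded_continuous => x; apply: continuous_comp.
  exact: bounded_linear_continuous (bop_bounded B) x.
exact: bounded_linear_continuous (bop_bounded A) _.
Qed.

Definition compop A B : boundedOp H := BoundedOp (compop_bounded A B).

Lemma compopA : associative compop.
Proof. by move=> A B C; exact: boundedOpP. Qed.

Lemma comp1op : left_id idop compop.
Proof. by move=> A; exact: boundedOpP. Qed.

Lemma compop1 : right_id idop compop.
Proof. by move=> A; exact: boundedOpP. Qed.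

HB.instance Definition _ :=
  isMonoid.Build (boundedOp H) compopA comp1op compop1.

(* Norms on an R[i]-module take values in R[i]; Re recovers the real number. *)
Definition opnorm A : R :=
  sup [set complex.Re `|A x| | x in [set x : H | `|x| <= 1]].

Definition is_adjoint A B : Prop :=
  forall x y : H, dotp H (A x) y = dotp H x (B y).

(* A bounded operator on a Hilbert space has exactly one adjoint. *)
Definition normal_op A : Prop :=
  exists2 B, is_adjoint A B & (A * B = B * A)%g.

End BoundedOpMonoid.

Section Representation.
Context (R : realType) (P : monoidType) (H : hilbertType R).

Definition representation (T : P -> boundedOp H) : Prop :=
  monoid.monoid_morphism T.

Definition contractive (T : P -> boundedOp H) : Prop :=
  forall p, opnorm (T p) <= 1.

Definition normal_rep (N : P -> boundedOp H) : Prop :=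
  representation N /\ forall p, normal_op (N p).

End Representation.

Definition generated_by (P : monoidType) (I : Type) (p : I -> P) :=
  forall x : P, exists s : seq I, x = (\prod_(i <- s) p i)%g.

(* The inclusion of H as a closed subspace of K is a linear isometry
   J : H -> K, whose range is closed because H is complete. *)
Definition hilbert_embedding (R : realType) (H K : hilbertType R)
    (J : {linear H -> K}) : Prop :=
  isometry (dotp K) (dotp H) J.

(* Both halves of the usual definition: S maps the image of H into itself, and
   its restriction there is T. *)
Definition extends (R : realType) (H K : hilbertType R) (J : {linear H -> K})
    (S : boundedOp K) (T : boundedOp H) : Prop :=
  forall x : H, S (J x) = J (T x).

(* Main.v *)
(* If the [N i] are commuting normal extensions, a word in the generators acts
   on L as the corresponding product of the [N i], but two words with the same
   value in P may act differently.  Let K be the closed subspace of L on which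
   they agree.  It contains H, and it is invariant under each [N i] and, because
   [N i] and the adjoint of [N j] commute (Fuglede), under the adjoints.  With Q
   the orthogonal projection onto K, the operators [N w * Q + (1 - Q)], for w
   any word representing x, form a normal representation on L itself, so no
   smaller Hilbert space has to be built.

   Fuglede's theorem is proved without exponentials.  For A normal with adjoint
   A', let [D f = A' f - f A'] on the operators f commuting with A.  Then
   [f + z D f = (1 + S) f (1 - S) + S f S] with [S = z A' - z^* A]
   skew-adjoint, whence [|f + z D f| <= (1 + c |z|^2) |f|].  Iterating n times
   at [|z| = s] gives a polynomial in z bounded by [(1 + c s^2)^n |f|], whose
   linear coefficient is [n D f].  Cauchy's estimate gives
   [n s |D f| <= (1 + c s^2)^n |f|], and [n = k^2], [s = 1 / (c k)] with k
   going to infinity forces [D f = 0]. *)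

Require Import Defs.
From HB Require Import structures.
From mathcomp Require Import all_boot all_order all_algebra.
From mathcomp Require Import all_classical all_reals topology normedtype.
From mathcomp Require Import complex.
From mathcomp Require Import ring.

Set Implicit Arguments.
Unset Strict Implicit.
Unset Printing Implicit Defensive.
Import Order.TTheory GRing.Theory Num.Theory.
Import numFieldNormedType.Exports.
Local Open Scope classical_set_scope.
Local Open Scope ring_scope.

(** * Cauchy estimates for vector-valued polynomials, by averaging over signs *)

Section CauchyEstimate.
Context (C : numClosedFieldType) (V : normedModType C).
Implicit Types v : nat -> V.

Lemma big_ord_double v n :
  \sum_(k < n.*2) v k = \sum_(k < n) v k.*2 + \sum_(k < n) v k.*2.+1.
Proof.
elim: n => [|n IHn]; first by rewrite !big_ord0 addr0.
by rewrite doubleS !big_ord_recr /= IHn addrACA !addrA.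
Qed.


(* The mean of the values at z and -z is a polynomial in z^2, of half the
   degree, with the same constant coefficient. *)
Lemma cauchy_estimate0 v m (r M : C) : 0 <= r ->
  (forall z, `|z| = r -> `|\sum_(k < 2 ^ m) z ^+ k *: v k| <= M) ->
  `|v 0| <= M.
Proof.
elim: m r v => [|m IHm] r v r0 vM.
  by have := vM r (ger0_norm r0); rewrite big_ord1 scale1r.
apply: (IHm (r ^+ 2) (fun k => v k.*2)); first exact: exprn_ge0.
move=> w wr; pose z := sqrtC w.
have zw : z ^+ 2 = w by exact: sqrtCK.
have zr : `|z| = r.
  by apply/eqP; rewrite -(@eqrXn2 _ 2) // -normrX zw wr.
have -> : \sum_(k < 2 ^ m) w ^+ k *: v k.*2 =
    2^-1 *: (\sum_(k < 2 ^ m.+1) z ^+ k *: v k +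
             \sum_(k < 2 ^ m.+1) (- z) ^+ k *: v k).
  rewrite expnS mul2n (big_ord_double (fun k => z ^+ k *: v k)).
  rewrite (big_ord_double (fun k => (- z) ^+ k *: v k)) addrACA.
  rewrite -big_split -big_split /=.
  rewrite [X in _ + X]big1 => [|k _]; last first.
    by rewrite !exprS -mul2n !exprM sqrrN mulNr scaleNr subrr.
  rewrite addr0 scaler_sumr; apply: eq_bigr => k _.
  rewrite -mul2n !exprM sqrrN zw -scalerDl scalerA; congr (_ *: _).
  by field.
rewrite normrZ normfV normr_nat ler_pdivrMl // mulr_natl mulr2n.
by apply: le_trans (ler_normD _ _) _; rewrite lerD ?vM ?normrN.
Qed.

(** Half the difference of the values at z and -z is z times a polynomial in z^2 whose constant
    coefficient is [v 1]. Scaled by r = |z|, that polynomial falls under [cauchy_estimate0] at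
    radius r^2. *)
Lemma cauchy_estimate1 v m (r M : C) : 0 <= r ->
  (forall z, `|z| = r -> `|\sum_(k < 2 ^ m.+1) z ^+ k *: v k| <= M) ->
  r * `|v 1| <= M.
Proof.
move=> r0 vM.
suff : `|r *: v 1%N| <= M by rewrite normrZ ger0_norm.
apply: (@cauchy_estimate0 (fun k => r *: v k.*2.+1) m (r ^+ 2)).
  exact: exprn_ge0.
move=> w wr; pose z := sqrtC w.
have zw : z ^+ 2 = w by exact: sqrtCK.
have zr : `|z| = r.
  by apply/eqP; rewrite -(@eqrXn2 _ 2) // -normrX zw wr.
have zE : z *: (\sum_(k < 2 ^ m) w ^+ k *: v k.*2.+1) =
    2^-1 *: (\sum_(k < 2 ^ m.+1) z ^+ k *: v k -
             \sum_(k < 2 ^ m.+1) (- z) ^+ k *: v k).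
  rewrite expnS mul2n (big_ord_double (fun k => z ^+ k *: v k)).
  rewrite (big_ord_double (fun k => (- z) ^+ k *: v k)).
  rewrite opprD addrACA -sumrB -sumrB /=.
  rewrite [X in X + _]big1 => [|k _]; last first.
    by rewrite -mul2n !exprM sqrrN subrr.
  rewrite add0r !scaler_sumr; apply: eq_bigr => k _.
  rewrite -mul2n !exprS !exprM sqrrN zw -scalerBl !scalerA; congr (_ *: _).
  by field.
under eq_bigr do rewrite scalerA mulrC -scalerA.
rewrite -scaler_sumr normrZ ger0_norm // -zr -normrZ zE.
rewrite normrZ normfV normr_nat ler_pdivrMl // mulr_natl mulr2n.
by apply: le_trans (ler_normB _ _) _; rewrite lerD ?vM ?normrN.
Qed.

End CauchyEstimate.

(** The binomial expansion of (1 + z T)^n. The terms beyond n vanish, so N can be a power of two, as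
    the Cauchy estimates require. *)
Lemma iter_addZ_binomial (K : comNzRingType) (V : lmodType K)
    (T : {linear V -> V}) (z : K) (f : V) (n N : nat) : (n < N)%N ->
  iter n (fun g => g + z *: T g) f =
  \sum_(k < N) z ^+ k *: ('C(n, k)%:R *: iter k T f).
Proof.
elim: n N => [|n IHn] [//|N] nN.
  rewrite big_ord_recl big1 /= => [|k _]; first by rewrite !scale1r addr0.
  by rewrite bin0n scale0r scaler0.
rewrite iterS {1}(IHn N.+1) ?ltnS 1?ltnW // (IHn N) // linear_sum.
rewrite scaler_sumr /= !big_ord_recl !bin0 -addrA -big_split /=; congr (_ + _).
apply: eq_bigr => k _; rewrite /bump add1n add0n !linearZ /=.
by rewrite !scalerA -scalerDl binS natrD exprS; congr (_ *: _); ring.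
Qed.

Lemma one_plus_expn_le2 (K : numFieldType) (u : K) n :
  0 <= u -> n%:R * u <= 2^-1 -> (1 + u) ^+ n <= 2.
Proof.
move=> u0 nu.
(* The induction rests on (1 + u)(1 - (n+1)u) <= 1 - n u, where the gap is exactly (n+1) u^2. *)
have le1 : (1 + u) ^+ n * (1 - n%:R * u) <= 1.
  elim: n {nu} => [|n IHn]; first by rewrite mul0r subr0 mulr1.
  apply: le_trans IHn; rewrite exprSr -mulrA ler_wpM2l ?exprn_ge0 ?addr_ge0 //.
  rewrite -subr_ge0.
  have -> : 1 - n%:R * u - (1 + u) * (1 - n.+1%:R * u) = n.+1%:R * u ^+ 2.
    by rewrite -natr1; ring.
  by rewrite mulr_ge0 // exprn_ge0.
have h : 2^-1 <= 1 - n%:R * u.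
  rewrite lerBrDr -lerBrDl (le_trans nu) // le_eqVlt; apply/orP; left.
  by apply/eqP; field.
rewrite -[leLHS]mulr1 -(@ler_pM2r _ 2^-1) ?invr_gt0 // divff ?pnatr_eq0 //.
by apply: le_trans le1; rewrite mulr1 ler_wpM2l // exprn_ge0 // addr_ge0.
Qed.

(** * Fuglede's theorem *)

Section Fuglede.
Context (R : realType) (H : hilbertType R).
Implicit Types (A B : boundedOp H) (f : H -> H).
Local Notation "''[' u , v ]" := (dotp H u v) : ring_scope.

(** The order of [R[i]] is partial, hence the negated form: w need not be comparable with any
    natural number. Comparable elements are ordered by their real parts. *)
Lemma complex_archimedean (w : R[i]) : exists k : nat, ~ (k.+1%:R <= w).
Proof.
exists (Num.trunc (complex.Re w)).
rewrite -(rmorph_nat (real_complex R)) lecE => /andP[_ /=].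
by rewrite leNgt truncnS_gt.
Qed.

Lemma dotpC (u v : H) : '[u, v] = ('[v, u])^*.
Proof. by rewrite hermC mul1r. Qed.

Lemma is_adjoint_sym A B : is_adjoint A B -> is_adjoint B A.
Proof. by move=> AB x y; rewrite dotpC -AB -dotpC. Qed.

Lemma bop_normP A : exists2 a : R[i], 1 <= a & forall x, `|A x| <= a * `|x|.
Proof.
have /linear_boundedP [r [rreal Ar]] := bop_bounded A.
exists (1 + `|r|); first by rewrite lerDl.
apply: Ar; rewrite (le_lt_trans (real_ler_norm rreal)) // ltrDr ltr01 //.
Qed.

(** For skew-adjoint S the cross terms of |x + S x|^2 cancel. *)
Lemma skew_add_norm (S : H -> H) x (s : R[i]) :
  (forall u v, '[S u, v] = - '[u, S v]) -> `|S x| <= s * `|x| ->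
  `|x + S x| ^+ 2 <= (1 + s ^+ 2) * `|x| ^+ 2.
Proof.
move=> Sskew Sx; rewrite -dotp_norm dnormD -dotpC Sskew subrr addr0 !dotp_norm.
by rewrite mulrDl mul1r lerD2l -exprMn lerXn2r ?nnegrE // (le_trans _ Sx).
Qed.

(** It acts on all functions, which form a module under pointwise operations, so that
    [iter_addZ_binomial] applies to it; [boundedOp H] is only given a monoid structure. *)
Definition commutator_with A f : H -> H := (A \o f) - (f \o A).

Lemma commutator_with_linear A : linear (commutator_with A).
Proof.
move=> z f g; apply/funext => x; rewrite /commutator_with !fctE /=.
by rewrite linearD linearZ /= scalerBr addrACA opprD.
Qed.

HB.instance Definition _ A :=
  GRing.isLinear.Build R[i] (H -> H) (H -> H) _ (commutator_with A)
    (commutator_with_linear A).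

Lemma commutator_step A A' f (a b z : R[i]) :
  is_adjoint A A' -> linear f -> 0 <= a -> 0 <= b ->
  (forall x, A (f x) = f (A x)) ->
  (forall x, `|A x| <= a * `|x|) -> (forall x, `|A' x| <= a * `|x|) ->
  (forall x, `|f x| <= b * `|x|) ->
  forall x, `|f x + z *: (A' (f x) - f (A' x))| <=
    (1 + 8 * a ^+ 2 * `|z| ^+ 2) * b * `|x|.
Proof.
move=> AA' flin a0 b0 Af Aa A'a fb x.
have fB u v : f (u - v) = f u - f v.
  by rewrite addrC -scaleN1r flin scaleN1r addrC.
have f0 : f 0 = 0 by rewrite -[X in f X](subrr 0) fB subrr.
have fZ k u : f (k *: u) = k *: f u by have := flin k u 0; rewrite f0 !addr0.
pose S u := z *: A' u - z^* *: A u.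
have S_skew u v : '[S u, v] = - '[u, S v].
  rewrite /S linearBl linearBr /= !linearZl_LR !linearZr_LR /= conjCK opprB.
  by rewrite (is_adjoint_sym AA') AA'.
(* Both halves of S are bounded by |z| a. Each summand of the decomposition below contributes one
   s^2, and 2 s^2 = 8 a^2 |z|^2. *)
pose s := 2 * `|z| * a.
have s0 : 0 <= s by rewrite !mulr_ge0.
have Ss u : `|S u| <= s * `|u|.
  apply: le_trans (ler_normB _ _) _; rewrite !normrZ norm_conjC -mulrDr.
  rewrite /s -!mulrA mulrCA ler_wpM2l // mulr_natl mulr2n lerD //.
(* As f commutes with A, only the [A'] half of S survives in S f - f S; the two terms S f S
   cancel. *)
have -> : f x + z *: (A' (f x) - f (A' x)) =
    (f (x - S x) + S (f (x - S x))) + S (f (S x)).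
  have SB u v : S (u - v) = S u - S v.
    by rewrite /S !linearB /= addrACA.
  rewrite fB SB -[RHS]addrA subrK -[RHS]addrA [- _ + S _]addrC; congr (_ + _).
  by rewrite /S fB !fZ -Af scalerBr opprB addrA subrK.
have le1 : `|f (x - S x) + S (f (x - S x))| <= (1 + s ^+ 2) * b * `|x|.
  rewrite -(@ler_pXn2r _ 2) ?nnegrE ?mulr_ge0 ?addr_ge0 ?exprn_ge0 //.
  apply: le_trans (skew_add_norm S_skew (Ss _)) _.
  have NSskew u v : '[- S u, v] = - '[u, - S v].
    by rewrite linearNl linearNr /= S_skew.
  have NSs : `|- S x| <= s * `|x| by rewrite normrN.
  have := skew_add_norm NSskew NSs => h.
  have fb2 : `|f (x - S x)| ^+ 2 <= b ^+ 2 * ((1 + s ^+ 2) * `|x| ^+ 2).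
    apply: le_trans (_ : b ^+ 2 * `|x - S x| ^+ 2 <= _).
      by rewrite -exprMn lerXn2r ?nnegrE ?mulr_ge0.
    by rewrite ler_wpM2l // exprn_ge0.
  have -> : ((1 + s ^+ 2) * b * `|x|) ^+ 2 =
      (1 + s ^+ 2) * (b ^+ 2 * ((1 + s ^+ 2) * `|x| ^+ 2)) by ring.
  by rewrite ler_wpM2l // addr_ge0 ?exprn_ge0.
have le2 : `|S (f (S x))| <= s ^+ 2 * b * `|x|.
  have -> : s ^+ 2 * b * `|x| = s * (b * (s * `|x|)) by ring.
  apply: le_trans (Ss _) _; rewrite ler_wpM2l //.
  by apply: le_trans (fb _) _; rewrite ler_wpM2l.
apply: le_trans (ler_normD _ _) _; apply: le_trans (lerD le1 le2) _.
by rewrite le_eqVlt; apply/orP; left; apply/eqP; rewrite /s; ring.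
Qed.

Lemma fuglede A A' B :
  is_adjoint A A' -> (A * B)%g = (B * A)%g -> (A * A')%g = (A' * A)%g ->
  (A' * B)%g = (B * A')%g.
Proof.
move=> AA' AB nA; apply: boundedOpP => x; apply/eqP; rewrite -subr_eq0.
have pt (C D : boundedOp H) :
    (C * D)%g = (D * C)%g -> forall u, C (D u) = D (C u).
  by move=> CD u; exact: (congr1 (fun E : boundedOp H => E u) CD).
have {}AB := pt _ _ AB; have {}nA := pt _ _ nA.
have [a a1 Aa'] := bop_normP A; have [a' a'1 A'a'] := bop_normP A'.
have [b b1 Bb] := bop_normP B.
pose d := a + a'.
have d0 : 0 <= d by rewrite addr_ge0 // (le_trans ler01).
have b0 : 0 <= b by rewrite (le_trans ler01).
have Aa u : `|A u| <= d * `|u|.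
  by rewrite (le_trans (Aa' u)) // ler_wpM2r // lerDl (le_trans ler01).
have A'a u : `|A' u| <= d * `|u|.
  by rewrite (le_trans (A'a' u)) // ler_wpM2r // lerDr (le_trans ler01).
pose c := 8 * d ^+ 2.
have c2 : 2 <= c.
  have : 1 <= d by rewrite (le_trans a1) // lerDl (le_trans ler01).
  move=> /(exprn_ege1 2); rewrite /c => h; apply: le_trans (_ : 8 * 1 <= _).
    by rewrite mulr1 ler_nat.
  by rewrite ler_wpM2l.
have c0 : 0 < c by rewrite (lt_le_trans _ c2).
pose T := commutator_with A'.
(* These are the conditions that [commutator_step] asks of g. Commuting with A is preserved because
   A commutes with [A']. *)
have iterT n z : let g := iter n (fun g => g + z *: T g) B in
    [/\ linear g, forall u, A (g u) = g (A u) &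
      forall u, `|g u| <= (1 + c * `|z| ^+ 2) ^+ n * b * `|u|].
  elim: n => [|n [glin Ag gb]] /=.
    by split=> [k u v|u|u]; rewrite ?linearP ?AB // mul1r.
  move: (iter n _ _) glin Ag gb => g glin Ag gb.
  split=> [k u v|u|u].
  - rewrite !fctE /T /commutator_with !fctE /= !(glin, linearP A') /=.
    rewrite opprD [X in z *: X]addrACA -scalerBr [z *: _]scalerDr.
    by rewrite [z *: (k *: _)]scalerA mulrC -scalerA addrACA -scalerDr.
  - rewrite !fctE /T /commutator_with !fctE /= linearD linearZ linearB /=.
    by rewrite nA !Ag nA.
  - rewrite exprS -(mulrA (1 + _)).
    have -> : (g + z *: T g) u = g u + z *: (A' (g u) - g (A' u)) by [].
    have b'0 : 0 <= (1 + c * `|z| ^+ 2) ^+ n * b.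
      rewrite mulr_ge0 // exprn_ge0 // addr_ge0 //.
      by rewrite mulr_ge0 ?exprn_ge0 // ltW.
    exact: (@commutator_step A A' g d _ z AA' glin d0 b'0 Ag Aa A'a gb u).
set y := (X in X == 0); apply: contrapT => /negP; rewrite -normr_gt0 => y0.
have [k] := complex_archimedean (2 * b * `|x| * c / `|y|); apply.
rewrite ler_pdivlMr //.
(* Then n s = (k+1)/c is unbounded in k while n c s^2 = 1/c <= 1/2, so that (1 + c s^2)^n <= 2. The
   Cauchy estimate yields the inequality that the choice of k excludes. *)
pose n := (k.+1 ^ 2)%N; pose s := (c * k.+1%:R)^-1.
have s0 : 0 <= s by rewrite invr_ge0 mulr_ge0 // ltW.
have ns2 : n%:R * (c * s ^+ 2) <= 2^-1.
  have -> : n%:R * (c * s ^+ 2) = c^-1.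
    rewrite /n /s natrX; field.
    by rewrite (gt_eqF c0) addrC natr1 pnatr_eq0.
  by rewrite lef_pV2 // posrE.
have cs0 : 0 <= c * s ^+ 2 by rewrite mulr_ge0 ?exprn_ge0 // ltW.
pose v j := 'C(n, j)%:R *: iter j T B x.
have /cauchy_estimate1 : forall z, `|z| = s ->
    `|\sum_(j < 2 ^ n.+1) z ^+ j *: v j| <= 2 * b * `|x|.
  move=> z zs.
  have -> : \sum_(j < 2 ^ n.+1) z ^+ j *: v j =
      iter n (fun g => g + z *: T g) B x.
    rewrite (@iter_addZ_binomial _ _ (commutator_with A') z B n (2 ^ n.+1)).
      by rewrite fct_sumE; apply: eq_bigr.
    by rewrite (leq_trans (ltn_expl n (ltnSn 1))) // leq_exp2l.
  have [_ _ /(_ x) h] := iterT n z; apply: le_trans h _.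
  by rewrite ler_wpM2r // ler_wpM2r // zs one_plus_expn_le2.
move=> /(_ s0); rewrite /v /= bin1 normrZ normr_nat.
have -> : `|commutator_with A' B x| = `|y| by [].
move=> h; rewrite -ler_pdivrMr // (le_trans _ h) // le_eqVlt; apply/orP; left.
apply/eqP; rewrite /s /n natrX; field.
by rewrite (gt_eqF c0) addrC natr1 pnatr_eq0.
Qed.

End Fuglede.

(** * Orthogonal projection onto a closed subspace *)

Section Projection.
Context (R : realType) (H : hilbertType R).
Implicit Types (K : set H) (u v x y : H).
Local Notation "''[' u , v ]" := (dotp H u v) : ring_scope.

Lemma parallelogram u v :
  `|u + v| ^+ 2 + `|u - v| ^+ 2 = 2 * `|u| ^+ 2 + 2 * `|v| ^+ 2.
Proof. by rewrite -!dotp_norm dnormD dnormB; ring. Qed.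

(* With [t = '[u, y] / |y|^2] this is Bessel's inequality, and it is
   Cauchy-Schwarz when [d = 0]. *)
Lemma dotp_le_of_dist u y (d : R[i]) :
  (forall t : R[i], d <= `|u - t *: y| ^+ 2) ->
  `|'[u, y]| ^+ 2 <= (`|u| ^+ 2 - d) * `|y| ^+ 2.
Proof.
have [->|y0 ud] := eqVneq y 0.
  by rewrite linear0r !normr0 expr0n mulr0.
have yy0 : 0 < `|y| ^+ 2 by rewrite exprn_gt0 // normr_gt0.
have yyN0 : `|y| ^+ 2 != 0 by rewrite gt_eqF.
have yyC : (`|y| ^+ 2)^* = `|y| ^+ 2 by rewrite conj_Creal // ger0_real // ltW.
have := ud ('[u, y] / `|y| ^+ 2).
rewrite -(dotp_norm (u - _)) dnormB /= dnormZ linearZr_LR /= !dotp_norm.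
move: (`|y| ^+ 2) yy0 yyN0 yyC ('[u, y]) => s s0 sN0 sC p.
rewrite !normCK !rmorphM !fmorphV /= !sC conjCK => h.
rewrite -ler_pdivrMr // lerBrDr -lerBrDl.
by apply: le_trans h _; rewrite le_eqVlt; apply/orP; left; apply/eqP; field.
Qed.

Lemma dotp_le_norm u y : `|'[u, y]| <= `|u| * `|y|.
Proof.
rewrite -(@ler_pXn2r _ 2) ?nnegrE ?mulr_ge0 // exprMn -[`|u| ^+ 2]subr0.
by apply: dotp_le_of_dist => t; rewrite exprn_ge0.
Qed.

(** Squared norms are real, so the infimum is taken in R and embedded back into [R[i]]. *)
Lemma dist_inf K x : K 0 -> exists2 d : R[i],
  forall k, K k -> d <= `|x - k| ^+ 2 &
  forall n, exists2 k, K k & `|x - k| ^+ 2 < d + n.+1%:R^-1.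
Proof.
move=> K0; pose q u := complex.Re (`|u| ^+ 2).
have qE u : `|u| ^+ 2 = (q u)%:C%C.
  apply/eqP; rewrite eq_complex /= eqxx /=.
  have : 0 <= `|u| ^+ 2 by rewrite exprn_ge0.
  by rewrite lecE => /andP[].
pose E := [set q (x - k) | k in K].
have E_ge0 : lbound E 0.
  by move=> _ [k Kk <-]; rewrite -ler0c -qE exprn_ge0.
have infE : has_inf E by split; [exists (q (x - 0)), 0|exists 0].
exists (inf E)%:C%C => [k Kk|n].
  by rewrite qE lecR ge_inf //; [exists 0|exists k].
have e0 : 0 < n.+1%:R^-1 :> R by rewrite invr_gt0.
have [_ [k Kk <-] qk] := inf_adherent e0 infE.
exists k => //; rewrite qE.
have -> : (n.+1%:R^-1 : R[i]) = (n.+1%:R^-1 : R)%:C%C.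
  by rewrite fmorphV rmorph_nat.
by rewrite -rmorphD ltcR.
Qed.

Lemma orthogonal_projection_exists K x :
  K 0 -> (forall (c : R[i]) u v, K u -> K v -> K (c *: u + v)) -> closed K ->
  exists2 k, K k & forall y, K y -> '[x - k, y] = 0.
Proof.
move=> K0 Klin Kcl.
have KZ (c : R[i]) u : K u -> K (c *: u).
  by move=> Ku; rewrite -[_ *: _]addr0; exact: Klin.
have KD u v : K u -> K v -> K (u + v).
  by move=> Ku Kv; rewrite -[u]scale1r; exact: Klin.
have [d dK dk] := dist_inf x K0.
pose k n := projT1 (cid2 (dk n)).
have kK n : K (k n) by rewrite /k; case: cid2.
have kd n : `|x - k n| ^+ 2 < d + n.+1%:R^-1 by rewrite /k; case: cid2.
(* Parallelogram law: the midpoint of [k m] and [k n] lies in K, so its squared distance to x is at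
   least d. *)
have k_cauchy n m : (n <= m)%N -> `|k n - k m| ^+ 2 < 4 * n.+1%:R^-1.
  move=> nm.
  have := parallelogram (x - k m) (x - k n).
  have -> : x - k m - (x - k n) = k n - k m by rewrite opprB addrC addrA subrK.
  have -> : x - k m + (x - k n) = 2 *: (x - 2^-1 *: (k m + k n)).
    rewrite scalerBr scalerA divff ?pnatr_eq0 // scale1r scaler_nat mulr2n.
    by rewrite opprD addrACA.
  have := dK _ (KZ 2^-1 _ (KD _ _ (kK m) (kK n))).
  rewrite normrZ exprMn normr_nat.
  move: (`|x - _| ^+ 2) => q dq par.
  have -> : `|k n - k m| ^+ 2 =
      2 * `|x - k m| ^+ 2 + 2 * `|x - k n| ^+ 2 - 2 ^+ 2 * q.
    by rewrite -par addrAC subrr add0r.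
  have km : `|x - k m| ^+ 2 < d + n.+1%:R^-1.
    by rewrite (lt_le_trans (kd m)) // lerD2l lef_pV2 ?posrE ?ler_nat.
  have -> : 4 * n.+1%:R^-1 =
      2 * (d + n.+1%:R^-1) + 2 * (d + n.+1%:R^-1) - 2 ^+ 2 * d.
    by ring.
  by rewrite ltr_leD ?ltrD ?ltr_pM2l ?kd // lerN2 ler_wpM2l // exprn_ge0.
have small (e : R[i]) : 0 < e -> exists N : nat, 4 * N.+1%:R^-1 < e.
  move=> e0; have [N hN] := complex_archimedean (4 / e); exists N.
  rewrite ltr_pdivrMr // mulrC -ltr_pdivrMr //.
  have er : 4 / e \is Num.real by rewrite ger0_real // divr_ge0 // ltW.
  by rewrite real_ltNge //; exact/negP.
have /cauchy_cvg/cvg_ex[l kl] : cauchy (k @ \oo).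
  apply/cauchyP => e e0; have [N hN] := small (e ^+ 2) (exprn_gt0 _ e0).
  exists (k N); exists N => // m /= Nm; rewrite -ball_normE /=.
  rewrite -(@ltr_pXn2r _ 2) ?nnegrE ?(ltW e0) //.
  exact: lt_trans (k_cauchy _ _ Nm) hN.
have Kl : K l.
  by apply: (closed_cvg _ Kcl _ _ kl); near=> n; exact: kK.
exists l => // y Ky.
(* One e|y| comes from l being close to [k n], the other from [k n] being nearly minimal, through
   [dotp_le_of_dist]. *)
have le_e (e : R[i]) : 0 < e -> `|'[x - l, y]| <= e * (2 * `|y|).
  move=> e0; have [N hN] := small (e ^+ 2) (exprn_gt0 _ e0).
  have [n [Nn kn]] : exists n, (N <= n)%N /\ `|l - k n| < e.
    have /filter_ex [n /= [? ?]] :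
        \forall n \near \oo, (N <= n)%N /\ `|l - k n| < e.
      apply: filterI; first exact: nbhs_infty_ge.
      by move/cvgrPdist_lt : kl; apply.
    by exists n.
  have -> : x - l = (x - k n) - (l - k n) by rewrite opprB addrA subrK.
  rewrite linearBl /=; apply: le_trans (ler_normB _ _) _.
  rewrite mulrCA mulr_natl mulr2n lerD //; last first.
    by rewrite (le_trans (dotp_le_norm _ _)) // ler_wpM2r // ltW.
  rewrite -(@ler_pXn2r _ 2) ?nnegrE ?mulr_ge0 ?(ltW e0) //.
  have h t : d <= `|x - k n - t *: y| ^+ 2.
    by rewrite -addrA -opprD; apply: dK; rewrite addrC; exact: Klin.
  apply: le_trans (dotp_le_of_dist h) _; rewrite exprMn ler_wpM2r ?exprn_ge0 //.
  rewrite lerBlDl (le_trans (ltW (kd n))) // lerD2l.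
  apply: le_trans (ltW hN); rewrite -[leLHS]mul1r.
  by rewrite ler_pM ?invr_ge0 ?ler1n ?lef_pV2 ?posrE ?ler_nat.
apply: contrapT => /eqP; rewrite -normr_gt0 => c0.
(* The summand 1 keeps the divisor positive when y = 0 and makes the resulting bound strictly too
   small. *)
have y1 : 0 < 2 * `|y| + 1 by rewrite ltr_wpDl ?mulr_ge0.
have := le_e _ (divr_gt0 c0 y1).
rewrite mulrAC ler_pdivlMr // ler_pM2l // gerDl.
by rewrite lt_geF.
Unshelve. all: by end_near. Qed.

End Projection.

(** * Projections and reducing subspaces *)

Section ReducingSubspace.
Context (R : realType) (H : hilbertType R).
Implicit Types (A B Q : boundedOp H) (K : set H) (u v x y : H).
Local Notation "''[' u , v ]" := (dotp H u v) : ring_scope.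

Definition reduces K A :=
  exists2 A', is_adjoint A A' &
    (forall x, K x -> K (A x)) /\ (forall x, K x -> K (A' x)).

Definition projects_onto Q K :=
  (forall x, K (Q x)) /\ (forall x y, K y -> '[x - Q x, y] = 0).

Lemma bounded_op_exists (f : H -> H) (M : R[i]) : linear f -> 0 <= M ->
  (forall x, `|f x| <= M * `|x|) -> exists A, forall x, A x = f x.
Proof.
move=> flin M0 fM.
pose g : {linear H -> H} := HB.pack f (GRing.isLinear.Build R[i] H H _ f flin).
suff gb : bounded_near g (nbhs (0 : H)) by exists (BoundedOp gb).
apply/linear_boundedP; exists M; split; first exact: ger0_real.
by move=> r Mr x; rewrite (le_trans (fM x)) // ler_wpM2r // ltW.
Qed.

Lemma orthogonal_projection_op K :
  K 0 -> (forall (c : R[i]) u v, K u -> K v -> K (c *: u + v)) -> closed K ->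
  exists Q, projects_onto Q K.
Proof.
move=> K0 Klin Kcl.
pose q x := projT1 (cid2 (orthogonal_projection_exists x K0 Klin Kcl)).
have Kq x : K (q x) by rewrite /q; case: cid2.
have qo x y : K y -> '[x - q x, y] = 0.
  by rewrite /q; case: cid2 => k /= _; exact.
(* Orthogonality determines the projected point; linearity of q follows from this uniqueness. *)
have qP x k : K k -> (forall y, K y -> '[x - k, y] = 0) -> q x = k.
  move=> Kk ko; apply/eqP; rewrite -subr_eq0 -(dnorm_eq0 (dotp H)).
  have Kqk : K (q x - k) by rewrite addrC -scaleN1r; exact: (Klin).
  have {1}-> : q x - k = (x - k) - (x - q x).
    by rewrite opprB [RHS]addrC addrA subrK.
  by rewrite linearBl /= ko // qo // subrr.
have qlin : linear q.
  move=> c u v; apply: qP; first exact: (Klin).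
  move=> y Ky; have -> : c *: u + v - (c *: q u + q v) =
      c *: (u - q u) + (v - q v) by rewrite opprD addrACA scalerBr.
  by rewrite linearDl /= linearZl_LR /= !qo // mulr0 addr0.
have qle x : `|q x| <= 1 * `|x|.
  have -> : `|x| = `|(x - q x) + q x| by rewrite subrK.
  rewrite mul1r -(@ler_pXn2r _ 2) ?nnegrE // -!dotp_norm.
  rewrite hnormDd ?lerDr ?dnorm_ge0 //.
  exact: qo.
have [Q QE] := bounded_op_exists qlin ler01 qle.
by exists Q; split=> [x|x y Ky]; rewrite QE ?qo.
Qed.

Lemma closed_equalizer A B : closed [set v | A v = B v].
Proof.
have -> : [set v | A v = B v] = (fun v => A v - B v) @^-1` [set 0].
  by apply/seteqP; split=> v /= [/eqP AB]; apply/eqP;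
    rewrite ?subr_eq0 // -subr_eq0.
apply: preimage_closed; last first.
  exact/accessible_closed_set1/hausdorff_accessible/norm_hausdorff.
by move=> v _; apply: continuousB;
  apply: bounded_linear_continuous; exact: bop_bounded.
Qed.

Lemma projects_onto_id Q K x : projects_onto Q K ->
  (forall u v, K u -> K v -> K (u - v)) -> K x -> Q x = x.
Proof.
move=> [KQ Qo] KB Kx; apply/esym/eqP; rewrite -subr_eq0 -(dnorm_eq0 (dotp H)).
by apply/eqP; apply: Qo; apply: KB.
Qed.

Lemma projects_onto_selfadjoint Q K : projects_onto Q K -> is_adjoint Q Q.
Proof.
move=> [KQ Qo] x y.
have -> : '[Q x, y] = '[Q x, Q y].
  apply/eqP; rewrite -subr_eq0 -linearBr /=; apply/eqP.
  by rewrite dotpC Qo // rmorph0.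
by apply/eqP; rewrite eq_sym -subr_eq0 -linearBl /=; apply/eqP; exact: Qo.
Qed.

(** The vector Q A x - A Q x lies in K because A preserves K, and is orthogonal to K because [A']
    does too: A (x - Q x) stays orthogonal to K. *)
Lemma projects_onto_commute Q K A : projects_onto Q K ->
  (forall u v, K u -> K v -> K (u - v)) -> reduces K A ->
  forall x, Q (A x) = A (Q x).
Proof.
move=> [KQ Qo] KB [A' AA' [KA KA']] x.
apply/eqP; rewrite -subr_eq0 -(dnorm_eq0 (dotp H)); apply/eqP.
have Kw : K (Q (A x) - A (Q x)) by apply: KB => //; exact: KA.
have {1}-> : Q (A x) - A (Q x) = A (x - Q x) - (A x - Q (A x)).
  by rewrite linearB /= opprB [RHS]addrC addrA subrK.
by rewrite linearBl /= AA' !Qo ?subrr //; exact: KA'.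
Qed.

End ReducingSubspace.

(** * Words in commuting normal operators *)

Section Words.
Context (R : realType) (L : hilbertType R) (I : Type) (N : I -> boundedOp L).
Context (N_normal : forall i, normal_op (N i)).
Context (N_comm : forall i j, (N i * N j = N j * N i)%g).
Local Notation word s := (\prod_(i <- s) N i)%g.

Lemma word_commute s t : (word s * word t = word t * word s)%g.
Proof.
apply: commute_prod => i _; apply/commute_sym; apply: commute_prod => j _.
exact: N_comm.
Qed.

(** The adjoint is the reversed product of the letters' adjoints, each commuting with every word by
    Fuglede. The case t = s is normality; general t makes the adjoint preserve any subspace on which
    two words agree. *)
Lemma word_adjoint s : exists2 B, is_adjoint (word s) B &
  forall t, (B * word t = word t * B)%g.
Proof.
elim: s => [|i s [B sB Bt]].
  by exists 1%g => [x y|t]; rewrite ?big_nil ?mul1g ?mulg1.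
have [N' NN' nN] := N_normal i.
have N't t : (N' * word t = word t * N')%g.
  apply: (fuglede NN' _ nN).
  by apply: commute_prod => j _; exact: N_comm.
exists (B * N')%g => [x y|t]; first by rewrite big_cons /= NN' sB.
by rewrite -mulgA N't mulgA Bt mulgA.
Qed.

End Words.

(** * Operators acting as the identity on the orthogonal complement *)

Section ExtensionByIdentity.
Context (R : realType) (H : hilbertType R).
Implicit Types (A B Q : boundedOp H) (K : set H).

Lemma extension_by_id_exists A Q :
  exists B : boundedOp H, forall x, B x = A (Q x) + (x - Q x).
Proof.
have [a a1 Aa] := bop_normP A; have [q q1 Qq] := bop_normP Q.
have a0 : 0 <= a := le_trans ler01 a1; have q0 : 0 <= q := le_trans ler01 q1.
apply: (@bounded_op_exists _ _ _ (a * q + (1 + q))).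
- move=> c u v; rewrite !linearP /= scalerDr scalerBr [RHS]addrACA.
  by congr (_ + _); rewrite addrACA scalerN.
- by rewrite !addr_ge0 ?mulr_ge0.
move=> x; rewrite !mulrDl mul1r (le_trans (ler_normD _ _)) // lerD //.
  by rewrite (le_trans (Aa _)) // -mulrA ler_wpM2l.
by rewrite (le_trans (ler_normB _ _)) // lerD.
Qed.

Definition extension_by_id Q A : boundedOp H :=
  projT1 (cid (extension_by_id_exists A Q)).

Lemma extension_by_idE Q A x : extension_by_id Q A x = A (Q x) + (x - Q x).
Proof. by rewrite /extension_by_id; case: cid. Qed.

(** The inner factor sends x to the sum of B (Q x), fixed by Q, and x - Q x, killed by Q; the outer
    factor treats the two separately. *)
Lemma extension_by_id_mul Q A B : (forall x, Q (Q x) = Q x) ->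
  (forall x, Q (B x) = B (Q x)) ->
  extension_by_id Q (A * B)%g = (extension_by_id Q A * extension_by_id Q B)%g.
Proof.
move=> QQ QB; apply: boundedOpP => x.
rewrite extension_by_idE [RHS]extension_by_idE !extension_by_idE /=.
have -> : Q (B (Q x) + (x - Q x)) = B (Q x).
  by rewrite linearD linearB /= QB QQ subrr addr0.
by rewrite [_ + _ - _]addrC addKr.
Qed.

(** Since A Q = Q A, its adjoint is [A'] Q. *)
Lemma extension_by_id_adjoint Q A A' : is_adjoint Q Q ->
  (forall x, Q (A x) = A (Q x)) -> is_adjoint A A' ->
  is_adjoint (extension_by_id Q A) (extension_by_id Q A').
Proof.
move=> QQ QA AA' x y; rewrite !extension_by_idE.
by rewrite linearDl linearDr linearBl linearBr /= -QA !QQ AA'.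
Qed.

End ExtensionByIdentity.

(** * From extensions of the generators to a normal representation, and back *)

Theorem corollary2p8 (R : realType) (P : monoidType) (I : Type)
    (p : I -> P) (H : hilbertType R) (T : P -> boundedOp H) :
  commutative (@monoid.mul P) ->
  generated_by p ->
  representation T ->
  contractive T ->
  (exists (L : hilbertType R) (J : {linear H -> L}) (N : I -> boundedOp L),
      hilbert_embedding J /\
      (forall i, normal_op (N i)) /\
      (forall i j, (N i * N j = N j * N i)%g) /\
      (forall i, extends J (N i) (T (p i))))
  <->
  (exists (K : hilbertType R) (J : {linear H -> K}) (N : P -> boundedOp K),
      hilbert_embedding J /\
      normal_rep N /\
      (forall x, extends J (N x) (T x))).
Proof.
move=> mulC gen Trep _; split; last first.
  move=> [K [J [N [J_emb [[[_ NM] N_normal] N_ext]]]]].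
  exists K, J, (fun i => N (p i)); split=> //; split; first by [].
  by split=> [i j|i]; [rewrite -!NM mulC|exact: N_ext].
move=> [L [J [N [J_emb [N_normal [N_comm N_ext]]]]]].
pose word s := (\prod_(i <- s) N i)%g.
pose same := [set st : seq I * seq I |
  (\prod_(i <- st.1) p i)%g = (\prod_(i <- st.2) p i)%g].
pose K : set L := \bigcap_(st in same) [set v | word st.1 v = word st.2 v].
have wordC s t v : word s (word t v) = word t (word s v).
  exact: (congr1 (fun A : boundedOp L => A v) (word_commute N_comm s t)).
have KB (c : R[i]) u v : K u -> K v -> K (c *: u + v).
  by move=> Ku Kv st st_eq /=; rewrite !linearP /= (Ku _ st_eq) (Kv _ st_eq).
have K0 : K 0 by move=> st _ /=; rewrite !linear0.
have KS u v : K u -> K v -> K (u - v).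
  by move=> Ku Kv; rewrite addrC -scaleN1r; exact: (KB).
have Kcl : closed K by apply: closed_bigI => st _; exact: closed_equalizer.
have wordJ s h : word s (J h) = J (T (\prod_(i <- s) p i)%g h).
  elim: s => [|i s IHs]; rewrite /word ?big_nil ?Trep.1 // !big_cons /= IHs.
  by rewrite Trep.2 N_ext.
(* On the image of H a word acts through T of its value, so words of equal value agree there. *)
have KJ h : K (J h) by move=> [s t] st_eq /=; rewrite !wordJ st_eq.
have Kword s v : K v -> K (word s v).
  by move=> Kv st st_eq /=; rewrite !(wordC _ s) (Kv _ st_eq).
have Kadj B v : (forall t, B * word t = word t * B)%g -> K v -> K (B v).
  move=> Bt Kv st st_eq /=.
  have Bw t u : word t (B u) = B (word t u).
    exact/esym/(congr1 (fun A : boundedOp L => A u) (Bt t)).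
  by rewrite !Bw (Kv _ st_eq).
have [Q QK] := orthogonal_projection_op K0 KB Kcl.
have Q_id x : K x -> Q x = x by exact: projects_onto_id QK KS.
have QQ x : Q (Q x) = Q x by apply: Q_id; exact: QK.1.
have Q_adj := projects_onto_selfadjoint QK.
have Q_comm := projects_onto_commute QK KS.
have Q_word s v : Q (word s v) = word s (Q v).
  have [B sB Bt] := word_adjoint N_normal N_comm s.
  by apply: Q_comm; exists B => //; split=> u; [exact: Kword|exact: Kadj].
pose w x := projT1 (cid (gen x)).
have wE x : (\prod_(i <- w x) p i)%g = x by rewrite /w; case: cid.
(* The words [w (x * y)] and [w x ++ w y] may differ, but have the same value. Q maps into K, where
   such words agree, so the choice of w does not matter and multiplicativity follows. *)
have extension_by_id_word s t :
    (\prod_(i <- s) p i)%g = (\prod_(i <- t) p i)%g ->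
    extension_by_id Q (word s) = extension_by_id Q (word t).
  move=> st_eq; apply: boundedOpP => v; rewrite !extension_by_idE.
  by rewrite (QK.1 v (s, t) st_eq).
exists L, J, (fun x => extension_by_id Q (word (w x))); split=> //;
  split; last first.
  by move=> x h; rewrite extension_by_idE Q_id // subrr addr0 wordJ wE.
split.
  split=> [|x y].
    rewrite (extension_by_id_word _ [::]) ?wE ?big_nil //.
    apply: boundedOpP => v.
    by rewrite extension_by_idE /word big_nil addrC subrK.
  rewrite (extension_by_id_word _ (w x ++ w y)) ?big_cat ?wE //.
  by rewrite /word big_cat extension_by_id_mul //; exact: Q_word.
move=> x; have [B sB Bt] := word_adjoint N_normal N_comm (w x).
(* K reduces B as well, with the word itself as the adjoint of B. *)
have QB v : Q (B v) = B (Q v).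
  apply: Q_comm; exists (word (w x)); first exact: is_adjoint_sym.
  by split=> u; [exact: Kadj|exact: Kword].
exists (extension_by_id Q B); first exact: extension_by_id_adjoint.
by rewrite -!extension_by_id_mul // Bt.
Qed.
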